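(* The following properties hold true: (i) The maximum depth mapping $$\alpha^* : \mathcal P(\mathbb S^{d-1}) \to \left[\tfrac{1}{d+1},1\right],\qquad P \mapsto \sup_{y \in \mathbb S^{d-1}} \mathrm{ahD}(y;P),$$ is (well defined with values in $[\frac{1}{d+1},1]$ and) upper semi-continuous. (ii) At any $P \in \mathcal P(\mathbb S^{d-1})$ that satisfies $P(\partial H) = 0$ for all $H \in \mathcal H_0$, the mapping $\alpha^*$ is continuous and $\alpha^*(P) \le 1/2$. Further, the median mapping $\mathfrak M$ is outer semi-continuous at $P$; that is, for any $P_n \xrightarrow{w} P$ as $n\to\infty$ in $\mathcal P(\mathbb S^{d-1})$ and $x_n \in \mathfrak M(P_n)$ for each $n = 1,2,\dots$, all cluster points of the sequence $\{x_n\}_{n=1}^\infty$ lie in $\mathfrak M(P)$. (iii) Let $P \in \mathcal P(\mathbb S^{d-1})$ satisfy $P(\partial H) = 0$ for all $H \in \mathcal H_0$ and be such that $\mathfrak M(P)$ is a singleton $\{x\}$. Take any $P_n \xrightarrow{w} P$ as $n\to\infty$ in $\mathcal P(\mathbb S^{d-1})$ and $x_n \in \mathfrak M(P_n)$, $n = 1,2,\dots$. Then there exists a subsequence $\{x_{n(k)}\}_{k=1}^\infty$ such that $x_{n(k)} \to x$ as $k\to\infty$. In particular, the median mapping $\mathfrak M$ is continuous at $P$ as a set-valued mapping (i.e., both outer and inner semi-continuous at $P$), and also continuous at $P$ in the sense of the Hausdorff distance, i.e. $\delta_H(\mathfrak M(P_n),\mathfrak M(P)) \to 0$ whenever $P_n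 \xrightarrow{w} P$ in $\mathcal P(\mathbb S^{d-1})$.
   Context: Let $d \ge 2$ be an integer, $\mathbb S^{d-1} = \{x \in \mathbb R^d : \|x\| = 1\}$, and let $\mathcal P(\mathbb S^{d-1})$ be the set of Borel probability measures on $\mathbb S^{d-1}$, endowed with the topology of weak convergence, denoted $P_n \xrightarrow{w} P$. For a Borel set $A \subseteq \mathbb R^d$ and $P \in \mathcal P(\mathbb S^{d-1})$, write $P(A) = P(A \cap \mathbb S^{d-1})$. For $u \in \mathbb S^{d-1}$ let $H_{0,u} = \{y \in \mathbb R^d : \langle y,u\rangle \ge 0\}$ and $\mathcal H_0 = \{H_{0,u} : u \in \mathbb S^{d-1}\}$; $\partial H$ is the topological boundary of $H$. The angular halfspace depth is $$\mathrm{ahD}(x;P) = \inf\{P(H_{0,u}) : u \in \mathbb S^{d-1},\ x \in H_{0,u}\},\qquad x \in \mathbb S^{d-1}.$$ The set of angular halfspace medians of $P$ is the non-empty compact set $\mathfrak M(P) = \{x \in \mathbb S^{d-1} : \mathrm{ahD}(x;P) = \alpha^*(P)\}$, where $\alpha^*(P) = \max_{y \in \mathbb S^{d-1}} \mathrm{ahD}(y;P)$. The set-valued map $\mathfrak M$ is outer semi-continuous at $P$ if for every $P_n \xrightarrow{w} P$ and $x_n \in \mathfrak M(P_n)$, all cluster points of $\{x_n\}$ lie in $\mathfrak M(P)$; it is inner semi-continuous at $P$ if for every $P_n \xrightarrow{w} P$ and every $x \in \mathfrak M(P)$ there exist, for all large $n$, points $x_n \in \mathfrak M(P_n)$ with $x_n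 \to x$. The Hausdorff distance of compact sets $K, L \subset \mathbb R^d$ is $\delta_H(K,L) = \max\{\sup_{x \in K}\inf_{y \in L}\|x-y\|, \sup_{x \in L}\inf_{y\in K}\|x-y\|\}$. *)

(* Defs.v *)
From HB Require Import structures.
From mathcomp Require Import all_boot all_order all_algebra.
From mathcomp Require Import all_classical all_reals all_analysis.

Set Implicit Arguments.
Unset Strict Implicit.
Unset Printing Implicit Defensive.

Import Order.TTheory GRing.Theory Num.Theory.
Import numFieldTopology.Exports numFieldNormedType.Exports.

Local Open Scope classical_set_scope.
Local Open Scope ring_scope.

(* The norm of ['rV[R]_d] provided by the library is the sup norm. It induces
   the usual topology of R^d, but the sphere and the Hausdorff distance refer
   to the Euclidean norm. *)
Definition dotp (R : realType) (d : nat) (x y : 'rV[R]_d) : R :=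
  \sum_(i < d) x ord0 i * y ord0 i.

Definition enorm (R : realType) (d : nat) (x : 'rV[R]_d) : R :=
  Num.sqrt (dotp x x).

(* S^(d-1) as a subspace of R^d. The proof of [1 < d] is a parameter of the
   type because measurable types of the library are inhabited. *)
Definition sphere (R : realType) (d : nat) (hd : (1 < d)%N) : Type :=
  set_type [set x : 'rV[R]_d | enorm x = 1].

Definition sphere_val (R : realType) (d : nat) (hd : (1 < d)%N)
  (x : sphere R hd) : 'rV[R]_d := \val x.
Coercion sphere_val : sphere >-> matrix.

Fact enorm_delta (R : realType) (d : nat) (i : 'I_d) :
  enorm (delta_mx ord0 i : 'rV[R]_d) = 1.
Proof.
rewrite /enorm /dotp (bigD1 i)//= big1 => [|j ji].
  by rewrite !mxE !eqxx mulr1 addr0 sqrtr1.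
by rewrite !mxE (negbTE ji) andbF mulr0.
Qed.

Definition sphere_point (R : realType) (d : nat) (hd : (1 < d)%N) :
    sphere R hd :=
  exist _ (delta_mx ord0 (Ordinal (ltnW hd))) (mem_set (enorm_delta _ _)).

HB.instance Definition _ (R : realType) (d : nat) (hd : (1 < d)%N) :=
  PseudoMetric.copy (sphere R hd)
    (set_type [set x : 'rV[R]_d | enorm x = 1]).
HB.instance Definition _ (R : realType) (d : nat) (hd : (1 < d)%N) :=
  isPointed.Build (sphere R hd) (sphere_point R hd).

Definition borel_sphere (R : realType) (d : nat) (hd : (1 < d)%N) :=
  g_sigma_algebraType (@open (sphere R hd)).

Definition sphere_prob (R : realType) (d : nat) (hd : (1 < d)%N) : Type :=
  probability (borel_sphere R hd) R.

Definition test_fun (R : realType) (d : nat) (hd : (1 < d)%N) : Type :=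
  {f : sphere R hd -> R | continuous f /\ bounded_fun f}.

Definition integrals (R : realType) (d : nat) (hd : (1 < d)%N)
    (P : sphere_prob R hd) : prod_topology (fun _ : test_fun R hd => R) :=
  fun f => (\int[P]_(x in [set: borel_sphere R hd]) (sval f x))%R.

(* The topology of weak convergence: the coarsest one for which integration
   of every bounded continuous function is continuous. *)
HB.instance Definition _ (R : realType) (d : nat) (hd : (1 < d)%N) :=
  Choice.copy (sphere_prob R hd) (probability (borel_sphere R hd) R).
HB.instance Definition _ (R : realType) (d : nat) (hd : (1 < d)%N) :=
  Topological.copy (sphere_prob R hd)
    (initial_topology (@integrals R d hd)).

Lemma weak_cvgP (R : realType) (d : nat) (hd : (1 < d)%N)
    (P_ : nat -> sphere_prob R hd) (P : sphere_prob R hd) :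
  (P_ n @[n --> \oo] --> P) <->
  forall f : sphere R hd -> R, continuous f -> bounded_fun f ->
    (\int[P_ n]_x f x)%R @[n --> \oo] --> (\int[P]_x f x)%R.
Proof.
split.
  move=> cvP f cf bf.
  pose F : test_fun R hd := exist _ f (conj cf bf).
  have h1 : {for P, continuous (@integrals R d hd)}.
    exact: (@initial_continuous (sphere_prob R hd) _ (@integrals R d hd)).
  have cvI : integrals (P_ n) @[n --> \oo] --> integrals P.
    exact: continuous_cvg h1 cvP.
  have prF : continuous
      (fun g : prod_topology (fun _ : test_fun R hd => R) => g F).
    exact: (@proj_continuous {classic (test_fun R hd)} (fun=> R) F).
  by have := cvg_comp _ _ cvI (prF (integrals P)).
move=> H.
have cvI : integrals (P_ n) @[n --> \oo] --> integrals P.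
  pose Tc (F : test_fun R hd) := Topological.class
    (initial_topology (fun g : test_fun R hd -> R => g F)).
  apply: (iffRL (@cvg_sup (test_fun R hd -> R) _ Tc _ (integrals P) _)).
  move=> -[f [cf bf]].
  move=> A [B [[C oC <-] /= CP] CA].
  have [N _ HN] := H f cf bf C (open_nbhs_nbhs (conj oC CP)).
  by exists N => // n /HN Cn; apply: CA.
move=> A [B [[C oC <-] /= CP] CA].
have [N _ HN] := cvI C (open_nbhs_nbhs (conj oC CP)).
by exists N => // n /HN Cn; apply: CA.
Qed.

(* P(A) = P(A `&` S^(d-1)) for A a subset of R^d. *)
Definition prob_of (R : realType) (d : nat) (hd : (1 < d)%N)
    (P : sphere_prob R hd) (A : set 'rV[R]_d) : \bar R :=
  P [set x : borel_sphere R hd | A (x : sphere R hd)].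

Definition halfspace (R : realType) (d : nat) (u : 'rV[R]_d) : set 'rV[R]_d :=
  [set y | 0 <= dotp y u].

Definition halfspaces (R : realType) (d : nat) (hd : (1 < d)%N) :
    set (set 'rV[R]_d) :=
  [set halfspace (u : 'rV[R]_d) | u in [set: sphere R hd]].

Definition boundary (T : topologicalType) (A : set T) : set T :=
  closure A `\` interior A.

Definition null_boundaries (R : realType) (d : nat) (hd : (1 < d)%N)
    (P : sphere_prob R hd) : Prop :=
  forall H, @halfspaces R d hd H -> prob_of P (boundary H) = 0%E.

Definition ahD (R : realType) (d : nat) (hd : (1 < d)%N)
    (P : sphere_prob R hd) (x : sphere R hd) : \bar R :=
  ereal_inf [set prob_of P (halfspace u) | u in
    [set u : sphere R hd | halfspace u x]].

Definition max_depth (R : realType) (d : nat) (hd : (1 < d)%N)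
    (P : sphere_prob R hd) : \bar R :=
  ereal_sup [set ahD P y | y in [set: sphere R hd]].

Definition medians (R : realType) (d : nat) (hd : (1 < d)%N)
    (P : sphere_prob R hd) : set (sphere R hd) :=
  [set x | ahD P x = max_depth P].

Definition upper_semicontinuous (R : realType) (T : topologicalType)
    (f : T -> \bar R) : Prop :=
  lower_semicontinuous (fun x => (- f x)%E).

Definition outer_semicontinuous_at (T S : topologicalType) (M : T -> set S)
    (t : T) : Prop :=
  forall (t_ : nat -> T) (s_ : nat -> S),
    t_ n @[n --> \oo] --> t -> (forall n, M (t_ n) (s_ n)) ->
    cluster (s_ n @[n --> \oo]) `<=` M t.

Definition inner_semicontinuous_at (T S : topologicalType) (M : T -> set S)
    (t : T) : Prop :=
  forall t_ : nat -> T, t_ n @[n --> \oo] --> t ->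
    forall s, M t s ->
    exists s_ : nat -> S,
      (\forall n \near \oo, M (t_ n) (s_ n)) /\ s_ n @[n --> \oo] --> s.

(* The value is +oo when exactly one of the two sets is empty. *)
Definition hausdorff_dist (R : realType) (d : nat) (K L : set 'rV[R]_d) :
    \bar R :=
  let excess (A B : set 'rV[R]_d) :=
    ereal_sup [set ereal_inf [set (enorm (x - y))%:E | y in B] | x in A] in
  maxe (excess K L) (excess L K).

(* Main.v *)
Require Import Defs.
From HB Require Import structures.
From mathcomp Require Import all_boot all_order all_algebra.
From mathcomp Require Import all_classical all_reals all_analysis.
From mathcomp Require Import measurable_realfun finmap lra.

Import Order.TTheory GRing.Theory Num.Theory.
Import numFieldTopology.Exports numFieldNormedType.Exports.

Local Open Scope classical_set_scope.
Local Open Scope ring_scope.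

(** The proof rests on joint semicontinuity in a measure and a direction. If
    [0 < dotp y u] holds on a set of [P]-mass greater than [a], then so does
    [c <= dotp y u] for some [c > 0]. A continuous function between the
    indicators of [c <= dotp y u] and [c / 2 <= dotp y u] shows that the latter
    set keeps mass greater than [a] under weak perturbation of [P], and by
    compactness it stays in the open halfspace under perturbation of [u]. Hence
    the mass of open halfspaces is jointly lower semicontinuous in the normal
    and the measure ([open_halfspace_lsc]), and by complementation the mass of
    closed halfspaces is jointly upper semicontinuous ([halfspace_usc]).

    Depth is an infimum of masses of closed halfspaces, so it is jointly upper
    semicontinuous in the point and the measure ([ahD_usc]). Compactness of the
    sphere, used in the form that a property holding locally near each point
    holds uniformly, then yields upper semicontinuity of the maximal depth
    ([max_depth_usc]) and existence of medians ([medians_nonempty]).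

    The bound [1/(d+1)] is the centerpoint argument. The complements of any
    [d+1] halfspaces of mass less than [1/(d+1)] have a common point, as the
    masses sum to less than one; Helly's theorem for open halfspaces through the
    origin ([helly_open_halfspaces], via Radon partitions) extends this to
    finitely many such halfspaces, and compactness to all of them at once. The
    common point could lie on some of the boundaries, but tilting a light
    halfspace towards the point keeps it light and would put the point inside.

    If great spheres are null, closed and open halfspaces have the same mass
    ([null_boundariesE]). So each mass is also lower semicontinuous, and since
    the normals of the halfspaces containing a fixed [x] form a compact set, the
    depth of [x], hence the maximal depth, is lower semicontinuous at [P]
    ([max_depth_lsc]). The bound [1/2] comes from the two opposite halfspaces
    with [x] on their common boundary. A point that is not a median of [P] has
    depth separated from the maximum, and semicontinuity preserves the gap for
    nearby points and measures ([near_not_median]); by compactness the medians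
    of measures near [P] lie in any given neighbourhood of the medians of [P]
    ([near_medians_sub]). The set-valued continuity statements all follow from
    this; when the median of [P] is unique, medians of [P_ n] even converge to
    it along the whole sequence ([medians_cvg]). *)

Set Implicit Arguments.
Unset Strict Implicit.
Unset Printing Implicit Defensive.

(** * Euclidean geometry of the sphere *)

Lemma dotpE (R : realType) (d : nat) (x y : 'rV[R]_d) :
  dotp x y = (x *m y^T) ord0 ord0.
Proof. by rewrite mxE; apply: eq_bigr => i _; rewrite mxE. Qed.

Lemma dotpC (R : realType) (d : nat) (x y : 'rV[R]_d) : dotp x y = dotp y x.
Proof. by apply: eq_bigr => i _; rewrite mulrC. Qed.

Lemma dotpDl (R : realType) (d : nat) (x y z : 'rV[R]_d) :
  dotp (x + y) z = dotp x z + dotp y z.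
Proof. by rewrite !dotpE mulmxDl mxE. Qed.

Lemma dotpZl (R : realType) (d : nat) (c : R) (x y : 'rV[R]_d) :
  dotp (c *: x) y = c * dotp x y.
Proof. by rewrite !dotpE -scalemxAl mxE. Qed.

Lemma dotpDr (R : realType) (d : nat) (x y z : 'rV[R]_d) :
  dotp x (y + z) = dotp x y + dotp x z.
Proof. by rewrite !(dotpC x) dotpDl. Qed.

Lemma dotpZr (R : realType) (d : nat) (c : R) (x y : 'rV[R]_d) :
  dotp x (c *: y) = c * dotp x y.
Proof. by rewrite !(dotpC x) dotpZl. Qed.

Lemma dotpNr (R : realType) (d : nat) (x y : 'rV[R]_d) :
  dotp x (- y) = - dotp x y.
Proof. by rewrite -scaleN1r dotpZr mulN1r. Qed.

Lemma dotp0l (R : realType) (d : nat) (y : 'rV[R]_d) : dotp 0 y = 0.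
Proof. by rewrite dotpE mul0mx mxE. Qed.

Lemma dotp_suml (R : realType) (d : nat) (I : finType) (A : pred I)
    (x : I -> 'rV[R]_d) (y : 'rV[R]_d) :
  dotp (\sum_(i | A i) x i) y = \sum_(i | A i) dotp (x i) y.
Proof.
rewrite dotpE mulmx_suml summxE.
by apply: eq_bigr => i _; rewrite dotpE.
Qed.

Lemma dotp_ge0 (R : realType) (d : nat) (x : 'rV[R]_d) : 0 <= dotp x x.
Proof. by apply: sumr_ge0 => i _; rewrite -expr2 sqr_ge0. Qed.

Lemma dotp_eq0 (R : realType) (d : nat) (x : 'rV[R]_d) :
  (dotp x x == 0) = (x == 0).
Proof.
apply/eqP/eqP => [xx0|->]; last exact: dotp0l.
apply/rowP => i; rewrite mxE; apply/eqP; rewrite -sqrf_eq0 expr2; apply/eqP.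
by apply: (psumr_eq0P _ xx0) => // j _; rewrite -expr2 sqr_ge0.
Qed.

Lemma enorm_sphere (R : realType) (d : nat) (hd : (1 < d)%N)
    (s : sphere R hd) : enorm (s : 'rV_d) = 1.
Proof. exact: (set_valP s). Qed.

Lemma dotp_sphere (R : realType) (d : nat) (hd : (1 < d)%N)
    (s : sphere R hd) : dotp (s : 'rV_d) s = 1.
Proof.
have /(congr1 (fun r => r ^+ 2)) := enorm_sphere s.
by rewrite /enorm sqr_sqrtr ?dotp_ge0// expr1n.
Qed.

Lemma sphere_exists (R : realType) (d : nat) (hd : (1 < d)%N) (x : 'rV[R]_d) :
  enorm x = 1 -> exists s : sphere R hd, s = x :> 'rV_d.
Proof.
move=> x1; pose s : sphere R hd := exist _ x (mem_set x1).
by exists s.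
Qed.

Lemma normalize (R : realType) (d : nat) (hd : (1 < d)%N) (x : 'rV[R]_d) :
  x != 0 -> exists s : sphere R hd, exists2 c : R, 0 < c & s = c *: x :> 'rV_d.
Proof.
move=> x0; have n0 : 0 < enorm x.
  by rewrite sqrtr_gt0 lt0r dotp_ge0 dotp_eq0 x0.
have n1 : enorm ((enorm x)^-1 *: x) = 1.
  rewrite {1}/enorm dotpZl dotpZr mulrA -expr2 sqrtrM ?sqr_ge0// sqrtr_sqr.
  by rewrite gtr0_norm ?invr_gt0// mulVf ?gt_eqF.
have [s sE] := sphere_exists hd n1.
by exists s, (enorm x)^-1; rewrite ?invr_gt0.
Qed.

Lemma halfspaceZ (R : realType) (d : nat) (c : R) (u : 'rV[R]_d) :
  0 < c -> halfspace (c *: u) = halfspace u.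
Proof.
by move=> c0; apply/funext => y; rewrite /halfspace/= dotpZr pmulr_rge0.
Qed.

Lemma exists_orthogonal (R : realType) (d : nat) (hd : (1 < d)%N)
    (x : 'rV[R]_d) : exists u : sphere R hd, dotp x u = 0.
Proof.
have : kermx x^T != 0.
  rewrite -mxrank_eq0 mxrank_ker -lt0n subn_gt0 mxrank_tr.
  exact: leq_ltn_trans (rank_leq_row x) hd.
case/rowV0Pn => v /sub_kermxP vx0 /(normalize hd)[u [c _ uE]].
by exists u; rewrite dotpC uE dotpZl dotpE vx0 mxE mulr0.
Qed.

Lemma dotp_continuous (R : realType) (d : nat) :
  continuous (fun p : 'rV[R]_d * 'rV[R]_d => dotp p.1 p.2).
Proof.
move=> p; apply: (@cvg_big R _ +%R 0 predT).
  exact: add_continuous.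
move=> i _; apply: cvgM.
  by apply: (@continuous_comp _ _ _ fst (fun v : 'rV[R]_d => v ord0 i));
    [exact: cvg_fst|exact: coord_continuous].
by apply: (@continuous_comp _ _ _ snd (fun v : 'rV[R]_d => v ord0 i));
  [exact: cvg_snd|exact: coord_continuous].
Qed.

Lemma cvg_line_at0 (R : realType) (d : nat) (u x : 'rV[R]_d) :
  u + t *: x @[t --> (0 : R)] --> u.
Proof.
have c : t @[t --> (0 : R)] --> (0 : R) by exact: cvg_id.
suff : u + t *: x @[t --> (0 : R)] --> u + 0 *: x by rewrite scale0r addr0.
by apply: cvgD; [exact: cvg_cst|exact: (cvgZr_tmp c)].
Qed.

Lemma nbhs_line (R : realType) (d : nat) (u x : 'rV[R]_d) (A : set 'rV[R]_d) :
  nbhs u A -> exists2 t : R, 0 < t & A (u + t *: x).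
Proof.
move=> nA; have cv := cvg_at_right_filter (@cvg_line_at0 R d u x).
near (0 : R)^'+ => t; exists t => //.
by near: t; exact: cv nA.
Unshelve. all: by end_near. Qed.

(** Tilting the normal [u] towards [x], and only then renormalizing it, moves
    [x] off the boundary of the halfspace. This is how weak inequalities
    [0 <= dotp x u] become strict, hence stable under perturbation of [x]. *)
Lemma tilted_halfspace (R : realType) (d : nat) (hd : (1 < d)%N)
    (x u : sphere R hd) (A : set 'rV[R]_d) :
  0 <= dotp x u -> nbhs (u : 'rV_d) A ->
  exists v : 'rV[R]_d, exists w : sphere R hd,
    [/\ A v, halfspace w = halfspace v & 0 < dotp x w].
Proof.
move=> xu /(nbhs_line (x : 'rV_d))[t t0 At].
set v := (X in A X) in At.
have xv : 0 < dotp x v.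
  by rewrite dotpDr dotpZr dotp_sphere mulr1 ltr_wpDl.
have v0 : v != 0.
  by apply: contraTneq xv => ->; rewrite dotpC dotp0l ltxx.
have [w [c c0 wE]] := normalize hd v0.
by exists v, w; rewrite wE halfspaceZ// dotpZr mulr_gt0.
Qed.

Lemma sphere_val_continuous (R : realType) (d : nat) (hd : (1 < d)%N) :
  continuous (@sphere_val R d hd).
Proof. exact: initial_continuous. Qed.

Lemma dotp_sphere_continuous (R : realType) (d : nat) (hd : (1 < d)%N) :
  continuous (fun p : sphere R hd * 'rV[R]_d => dotp p.1 p.2).
Proof.
move=> p; apply: (@continuous_comp _ ('rV[R]_d * 'rV[R]_d)%type _
  (fun p : sphere R hd * 'rV[R]_d => (sphere_val p.1, p.2))
  (fun p => dotp p.1 p.2)).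
  have c1 : sphere_val q.1 @[q --> p] --> sphere_val p.1.
    by apply: (@continuous_comp _ _ _ fst (@sphere_val R d hd));
      [exact: cvg_fst|exact: sphere_val_continuous].
  have c2 : q.2 @[q --> p] --> p.2 by exact: cvg_snd.
  exact: (cvg_pair c1 c2).
exact: dotp_continuous.
Qed.

Lemma sphere_compact (R : realType) (d : nat) (hd : (1 < d)%N) :
  compact [set: sphere R hd].
Proof.
have cK : compact [set x : 'rV[R]_d | enorm x = 1].
  have cC : compact [set v : 'rV[R]_d | forall i, `[(-1), 1]%classic (v ord0 i)].
    apply: (@rV_compact R d (fun=> `[(-1), 1]%classic)) => i.
    exact: segment_compact.
  apply: (subclosed_compact _ cC).
    rewrite (_ : mkset _ = (fun x : 'rV[R]_d => dotp x x) @^-1` [set 1]).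
      apply: preimage_closed => [x _|]; last exact: closed_eq.
      apply: (@continuous_comp _ ('rV[R]_d * 'rV[R]_d)%type _
        (fun x => (x, x)) (fun p => dotp p.1 p.2)).
        have c : y @[y --> x] --> x by exact: cvg_id.
        exact: (cvg_pair c c).
      exact: dotp_continuous.
    apply/seteqP; split=> x /= x1.
      by rewrite -(sqr_sqrtr (dotp_ge0 x)) -/(enorm x) x1 expr1n.
    by rewrite /enorm x1 sqrtr1.
  move=> x /= x1 i; have : dotp x x = 1.
    by rewrite -(sqr_sqrtr (dotp_ge0 x)) -/(enorm x) x1 expr1n.
  rewrite /dotp (bigD1 i)//= -expr2 => xx1.
  rewrite in_itv/= -ler_norml -(@expr_le1 _ 2)// real_normK ?num_real//.
  by rewrite -xx1 lerDl sumr_ge0// => j _; rewrite -expr2 sqr_ge0.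
move=> F PF _.
have [] := cK (@sphere_val R d hd @ F) _.
  by apply: (@filterS _ F _ setT) => [s _|]; [exact: enorm_sphere|exact: filterT].
move=> p [p1 clp].
have [q qp] := sphere_exists hd p1; exists q.
split=> // A B FA [C [[D oD DC] Cp] CB].
have [] := clp [set x | exists2 s, A s & x = sphere_val s] D.
- by apply: (@filterS _ F _ A) => [s As|]; [exists s|].
- by apply: open_nbhs_nbhs; split=> //; rewrite -DC /= in Cp; rewrite -qp.
move=> _ [[s As ->] Ds]; exists s; split=> //; apply: CB.
by rewrite -DC.
Qed.

(** * Helly's theorem for open halfspaces through the origin *)

(** More than [d + 1] vectors [(1, x i)] in dimension [1 + d] are linearly
    dependent. *)
Lemma affine_dependence (R : realType) (d : nat) (I : finType) (A : {set I})
    (x : I -> 'rV[R]_d) : (d.+1 < #|A|)%N ->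
  exists a : I -> R, [/\ \sum_(i in A) a i = 0, \sum_(i in A) a i *: x i = 0 &
    exists2 i, i \in A & a i != 0].
Proof.
move=> dA; have /card_gt0P[i0 Ai0] : (0 < #|A|)%N by exact: leq_trans dA.
pose M : 'M[R]_(#|A|, 1 + d) := \matrix_(k < #|A|) row_mx 1 (x (enum_val k)).
have : kermx M != 0.
  rewrite -mxrank_eq0 mxrank_ker -lt0n subn_gt0.
  exact: leq_ltn_trans (rank_leq_col M) dA.
case/rowV0Pn => v /sub_kermxP vM0 v0.
pose a i := v ord0 (enum_rank_in Ai0 i).
have aE k : a (enum_val k) = v ord0 k by rewrite /a enum_valK_in.
have : \sum_k v ord0 k *: row_mx (1 : 'M[R]_1) (x (enum_val k)) = 0 :> 'rV_(1 + d).
  rewrite -[RHS]vM0 mulmx_sum_row; apply: eq_bigr => k _.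
  by rewrite rowK.
under eq_bigr do rewrite scale_row_mx -aE.
move=> sum0.
exists a; split.
- rewrite big_enum_val/=.
  have /(congr1 (fun m : 'M[R]_1 => m ord0 ord0)) := congr1 lsubmx sum0.
  rewrite linear_sum summxE linear0 mxE; apply: etrans.
  by apply: eq_bigr => k _; rewrite /= row_mxKl !mxE eqxx mulr1.
- rewrite big_enum_val/=; have := congr1 rsubmx sum0.
  rewrite linear_sum linear0; apply: etrans.
  by apply: eq_bigr => k _; rewrite /= row_mxKr.
- have /rV0Pn[k vk0] := v0.
  by exists (enum_val k); rewrite ?enum_valP// aE.
Qed.

(** Radon's proof of Helly's theorem: solve the system with each constraint [i]
    dropped in turn, getting [x i], and split an affine dependence of the [x i]
    by sign. The two halves are the same vector, and a constraint [j] is met by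
    every [x i] of the half that does not contain [x j]. Only conical
    combinations are needed, since the halfspaces are cones. The bound is
    [d + 1] and not [d]: for [d = 1] the normals [1] and [-1] are solvable one
    by one but not together. *)
Lemma helly_open_halfspaces (R : realType) (d : nat) (I : finType)
    (u : I -> 'rV[R]_d) :
  (forall A : {set I}, (#|A| <= d.+1)%N ->
     exists x, forall i, i \in A -> dotp x (u i) < 0) ->
  exists x, forall i, dotp x (u i) < 0.
Proof.
move=> few; suff H n (A : {set I}) : (#|A| <= n)%N ->
    exists x, forall i, i \in A -> dotp x (u i) < 0.
  have [x xu] := H _ finset.setT (leqnn _).
  by exists x => i; apply: xu; rewrite finset.in_setT.
elim: n A => [|n IH] A An; first by apply: few; exact: leq_trans An _.
have [/few//|dA] := leqP #|A| d.+1.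
have /choice[x xP] : forall i, exists x, i \in A ->
    forall j, j \in A :\ i -> dotp x (u j) < 0.
  move=> i; have [iA|] := boolP (i \in A); last by exists 0.
  have [|x xA] := IH (A :\ i); last by exists x.
  by rewrite -ltnS (leq_trans _ An)// [in leqRHS](cardsD1 i) iA.
have neg_comb (b : I -> R) : (exists2 i, i \in A & 0 < b i) ->
    forall j, j \in A -> b j <= 0 ->
    dotp (\sum_(i in A | 0 < b i) b i *: x i) (u j) < 0.
  move=> [i iA bi] j jA bj; rewrite dotp_suml.
  have bx k : k \in A -> 0 < b k -> dotp (b k *: x k) (u j) < 0.
    move=> kA bk; rewrite dotpZl pmulr_rlt0//; apply: xP => //.
    by rewrite !inE jA andbT; apply: contraTneq bj => ->; rewrite -ltNge.
  rewrite (bigD1 i) ?iA//= ltr_wnDr ?bx//.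
  by apply: sumr_le0 => k /andP[/andP[kA bk] _]; rewrite ltW// bx.
(* Since the coefficients sum to zero, both signs occur: negating [a] if
   needed, [i] is a positive index, and [l] below a negative one. *)
have [a [a0 ax0 [i iA ai0]]] := affine_dependence x dA.
wlog ai : a a0 ax0 ai0 / 0 < a i.
  move=> W; have [|ai|/eqP] := ltgtP 0 (a i); [exact: W| |].
    2: by rewrite eq_sym (negbTE ai0).
  apply: (W (fun k => - a k)); rewrite ?oppr_eq0 ?oppr_gt0 ?sumrN ?a0 ?oppr0//.
  by under eq_bigr do rewrite scaleNr; rewrite sumrN ax0 oppr0.
have [l lA al] : exists2 l, l \in A & 0 < - a l.
  apply: contrapT => nl; have ge0 k : k \in A -> 0 <= a k.
    move=> kA; rewrite leNgt; apply/negP => ak; apply: nl.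
    by exists k => //; rewrite oppr_gt0.
  by move: ai0; rewrite (psumr_eq0P ge0 a0)// eqxx.
have xE : \sum_(k in A | 0 < a k) a k *: x k =
    \sum_(k in A | 0 < - a k) - a k *: x k.
  apply/eqP; rewrite -subr_eq0 -sumrN; apply/eqP.
  under [X in _ + X]eq_bigr do rewrite scaleNr opprK.
  rewrite -[RHS]ax0 [RHS](bigID (fun k => 0 < a k))/=; congr (_ + _).
  rewrite [RHS](bigID (fun k => a k == 0))/= [X in _ = X + _]big1 ?add0r.
    apply: eq_bigl => k.
    by rewrite oppr_gt0 -andbA -leNgt lt_neqAle (andbC (a k <= 0)).
  by move=> k /andP[_ /eqP ->]; rewrite scale0r.
exists (\sum_(k in A | 0 < a k) a k *: x k) => j jA.
have [aj|aj] := leP (a j) 0; first by apply: neg_comb => //; exists i.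
rewrite xE; apply: (neg_comb (fun k => - a k)) => //; first by exists l.
by rewrite oppr_le0 ltW.
Qed.

(** * Masses of halfspaces as functions of the normal and the measure *)

Definition open_halfspace (R : realType) (d : nat) (u : 'rV[R]_d) : set 'rV[R]_d :=
  [set y | 0 < dotp y u].

Lemma halfspaceC (R : realType) (d : nat) (u : 'rV[R]_d) :
  halfspace u = ~` open_halfspace (- u).
Proof.
apply/funext => y; apply/propext; rewrite /halfspace/open_halfspace/= dotpNr.
by rewrite oppr_gt0 leNgt; split => [/negP|/negP].
Qed.

Lemma open_borel (R : realType) (d : nat) (hd : (1 < d)%N)
    (A : set (sphere R hd)) : open A -> measurable (A : set (borel_sphere R hd)).
Proof. by move=> oA; apply: sub_sigma_algebra. Qed.

Lemma closed_borel (R : realType) (d : nat) (hd : (1 < d)%N)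
    (A : set (sphere R hd)) : closed A -> measurable (A : set (borel_sphere R hd)).
Proof.
move=> cA; rewrite -[A]setCK; apply: measurableC.
by apply: open_borel; exact: closed_openC.
Qed.

Lemma continuous_borel (R : realType) (d : nat) (hd : (1 < d)%N)
    (f : sphere R hd -> R) : continuous f ->
  measurable_fun setT (f : borel_sphere R hd -> R).
Proof.
move=> /continuousP cf.
apply: (measurability _ (RGenOpens.measurableE R)).
move=> _ [_ [a [b ->]] <-]; rewrite setTI; apply: open_borel; apply: cf.
exact: interval_open.
Qed.

Lemma dotpl_continuous (R : realType) (d : nat) (hd : (1 < d)%N) (u : 'rV[R]_d) :
  continuous (fun y : sphere R hd => dotp y u).
Proof.
move=> y; have c1 : z @[z --> y] --> y by exact: cvg_id.
have c2 : u @[z --> y] --> u by exact: (@cvg_cst _ u _ (nbhs y)).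
exact: (cvg_comp _ _ (cvg_pair c1 c2) (@dotp_sphere_continuous R d hd (y, u))).
Qed.

Lemma closed_ge_dotp (R : realType) (d : nat) (hd : (1 < d)%N) (u : 'rV[R]_d)
    (c : R) :
  closed [set y : sphere R hd | c <= dotp y u].
Proof.
apply: (@preimage_closed _ _ (fun y : sphere R hd => dotp y u) [set x | c <= x]).
  by move=> y _; exact: dotpl_continuous.
exact: closed_ge.
Qed.

Lemma open_halfspace_open (R : realType) (d : nat) (hd : (1 < d)%N) (u : 'rV[R]_d) :
  open [set y : sphere R hd | open_halfspace u y].
Proof.
apply: (@open_comp _ _ (fun y : sphere R hd => dotp y u) [set x | 0 < x]).
  by move=> y _; exact: dotpl_continuous.
exact: open_gt.
Qed.

Lemma Rintegral_weak_continuous (R : realType) (d : nat) (hd : (1 < d)%N)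
    (f : sphere R hd -> R) : continuous f -> bounded_fun f ->
  continuous (fun Q : sphere_prob R hd =>
    (\int[Q]_(x in [set: borel_sphere R hd]) f x)%R).
Proof.
move=> cf bf Q; pose F : test_fun R hd := exist _ f (conj cf bf).
have prF : continuous
    (fun g : prod_topology (fun _ : test_fun R hd => R) => g F).
  exact: (@proj_continuous {classic (test_fun R hd)} (fun=> R) F).
have cI : {for Q, continuous (@integrals R d hd)}.
  exact: (@initial_continuous (sphere_prob R hd) _ (@integrals R d hd)).
exact: (continuous_comp cI (prF _)).
Qed.

(** Portmanteau-style transfer: a continuous [f] with [1_A <= f <= 1_C] passes a
    strict lower bound on the mass of [A] to the mass of [C] for all measures in
    a weak neighbourhood. *)
Lemma prob_gt_near (R : realType) (d : nat) (hd : (1 < d)%N)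
    (P : sphere_prob R hd) (A C : set (sphere R hd)) (f : sphere R hd -> R) (a : R) :
  measurable (A : set (borel_sphere R hd)) ->
  measurable (C : set (borel_sphere R hd)) ->
  continuous f -> (forall y, 0 <= f y <= 1) ->
  A `<=` [set y | f y = 1] -> [set y | f y != 0] `<=` C ->
  (a%:E < P (A : set (borel_sphere R hd)))%E ->
  \forall Q \near P, (a%:E < (Q : sphere_prob R hd) (C : set (borel_sphere R hd)))%E.
Proof.
move=> mA mC cf f01 A1 C0 aP.
have bf : bounded_fun f.
  exists 1; split=> // M M1 y _; have /andP[f0 f1] := f01 y.
  by rewrite /= ger0_norm// (le_trans f1)// ltW.
have mf := continuous_borel cf.
have intf (Q : sphere_prob R hd) :
    Q.-integrable [set: borel_sphere R hd] (EFin \o f).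
  apply: measurable_bounded_integrable => //.
  exact: (le_lt_trans (probability_le1 _ measurableT) (ltry _)).
have iE (Q : sphere_prob R hd) :
    (\int[Q]_(x in [set: borel_sphere R hd]) f x)%:E =
    (\int[Q]_(x in [set: borel_sphere R hd]) (f x)%:E)%E.
  by rewrite fineK//; exact: (integrable_fin_num measurableT (intf Q)).
have aPf : a < \int[P]_(x in [set: borel_sphere R hd]) f x.
  rewrite -lte_fin iE (lt_le_trans aP)//.
  rewrite -[A in leLHS]setIT -integral_indic//.
  apply: ge0_le_integral => //.
  - exact/measurable_EFinP/measurable_indic.
  - exact/measurable_EFinP.
  - move=> y _; rewrite lee_fin indicE; have [/set_mem/A1 ->//|_] := boolP (y \in A).
    by have /andP[] := f01 y.
near=> Q.
have : a < \int[Q]_(x in [set: borel_sphere R hd]) f x.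
  near: Q.
  exact: (@Rintegral_weak_continuous R d hd f cf bf P _
    (open_nbhs_nbhs (conj (@open_gt R a) aPf))).
rewrite -lte_fin iE => /lt_le_trans; apply.
rewrite -[C in leRHS]setIT -integral_indic//.
apply: ge0_le_integral => //.
- by move=> y _; rewrite lee_fin; have /andP[] := f01 y.
- exact/measurable_EFinP.
- exact/measurable_EFinP/measurable_indic.
- move=> y _; rewrite lee_fin indicE; have [_|] := boolP (y \in C).
    by have /andP[] := f01 y.
  apply: contraNT => fy0; apply/mem_set/C0; rewrite /= eq_le.
  by apply: contraNN fy0 => /andP[].
Unshelve. all: by end_near. Qed.

Lemma measurable_open_halfspace (R : realType) (d : nat) (hd : (1 < d)%N)
    (u : 'rV[R]_d) :
  measurable [set y : borel_sphere R hd | open_halfspace u (y : sphere R hd)].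
Proof. by apply: open_borel; exact: open_halfspace_open. Qed.

Lemma compact_closed_ge (R : realType) (d : nat) (hd : (1 < d)%N) (u : 'rV[R]_d)
    (c : R) :
  compact [set y : sphere R hd | c <= dotp y u].
Proof.
apply: (@subclosed_compact _ _ [set: sphere R hd]) => //.
  exact: closed_ge_dotp.
exact: sphere_compact.
Qed.

Lemma near_dotp_gt0 (R : realType) (d : nat) (hd : (1 < d)%N)
    (y : sphere R hd) (u : 'rV[R]_d) :
  0 < dotp y u -> \forall z \near y & v \near u, 0 < dotp (z : sphere R hd) v.
Proof.
move=> yu; exact: (@dotp_sphere_continuous R d hd (y, u) _
  (open_nbhs_nbhs (conj (@open_gt R 0) yu))).
Qed.

(** A compact slice [c / 2 <= dotp y u] carries enough mass, and stays inside
    the open halfspace when the normal is perturbed. The normal ranges over the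
    whole space, not only over the sphere, so that it can be perturbed without
    renormalizing. *)
Lemma open_halfspace_lsc (R : realType) (d : nat) (hd : (1 < d)%N)
    (P : sphere_prob R hd) (u : 'rV[R]_d) (a : R) :
  (a%:E < prob_of P (open_halfspace u))%E ->
  \forall v \near u & Q \near P, (a%:E < prob_of Q (open_halfspace v))%E.
Proof.
move=> aP.
pose A (k : nat) := [set y : sphere R hd | k.+1%:R^-1 <= dotp y u].
have AE : [set y : borel_sphere R hd | open_halfspace u (y : sphere R hd)] =
    \bigcup_k (A k : set (borel_sphere R hd)).
  apply/seteqP; split=> [y /= y0|y [k _]]; last first.
    by apply: lt_le_trans; rewrite invr_gt0 ltr0n.
  exists (Num.truncn (dotp (y : sphere R hd) u)^-1) => //.
  rewrite /A/= -[leRHS]invrK lef_pV2 ?posrE ?invr_gt0 ?ltr0n//.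
  exact/ltW/truncnS_gt.
have [k ak] : exists k, (a%:E < P (A k : set (borel_sphere R hd)))%E.
  apply: contrapT => /forallNP aA.
  have : P (A k : set (borel_sphere R hd)) @[k --> \oo] -->
      prob_of P (open_halfspace u).
    rewrite /prob_of AE; apply: nondecreasing_cvg_mu.
    - by move=> k; apply: closed_borel; exact: closed_ge_dotp.
    - by rewrite -AE; exact: measurable_open_halfspace.
    - move=> m n mn; apply/subsetPset => y; apply: le_trans.
      by rewrite lef_pV2 ?posrE ?ltr0n// ler_nat.
  move=> cvA; suff : (prob_of P (open_halfspace u) <= a%:E)%E.
    by rewrite leNgt aP.
  apply: (cvge_le _ cvA); apply: nearW => k.
  by rewrite leNgt; apply/negP; exact: aA.
pose c : R := k.+1%:R^-1; have c0 : 0 < c by rewrite invr_gt0 ltr0n.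
(* The ramp that vanishes below [c / 2] and equals [1] above [c]. *)
pose h (t : R) := Num.min 1 (Num.max 0 (2 / c * t - 1)).
have ch : continuous h.
  move=> t; apply: (@continuous_min R R (fun=> 1)
    (fun t => Num.max 0 (2 / c * t - 1))); first exact: cvg_cst.
  apply: (@continuous_max R R (fun=> 0) (fun t => 2 / c * t - 1)).
    exact: cvg_cst.
  by apply: cvgB; [apply: cvgM; [exact: cvg_cst|exact: cvg_id]|exact: cvg_cst].
pose f (y : sphere R hd) := h (dotp y u).
have cf : continuous f.
  move=> y; apply: (@continuous_comp _ _ _ (fun y : sphere R hd => dotp y u) h).
    exact: dotpl_continuous.
  exact: ch.
pose C := [set y : sphere R hd | c / 2 <= dotp y u].
have nearQ : \forall Q \near P,
    (a%:E < (Q : sphere_prob R hd) (C : set (borel_sphere R hd)))%E.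
  apply: (prob_gt_near (A := A k) (f := f)) => //.
  - by apply: closed_borel; exact: closed_ge_dotp.
  - by apply: closed_borel; exact: closed_ge_dotp.
  - by move=> y; rewrite /f/h le_min ler01 le_max lexx ge_min lexx.
  - move=> y; rewrite /A /= -/c => cy; rewrite /f/h.
    have h1 : 1 <= 2 / c * dotp y u - 1.
      have : 1 <= c^-1 * dotp y u by rewrite mulrC ler_pdivlMr// mul1r.
      lra.
    by rewrite max_r ?(le_trans _ h1)// min_l.
  - move=> y; apply: contraNT; rewrite /C/= -ltNge => yc.
    rewrite /f/h max_l ?min_r//.
    have : c^-1 * dotp y u <= 1 / 2.
      by rewrite mulrC ler_pdivrMr// mulrC mulrA mulr1 ltW.
    lra.
have nearv : \forall v \near u, C `<=` [set y | open_halfspace v (y : sphere R hd)].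
  have /compact_near_coveringP K := @compact_closed_ge R d hd u (c / 2).
  apply: (K _ (nbhs u) (fun v (y : sphere R hd) => open_halfspace v y)) => y /= yu.
  by apply: near_dotp_gt0; rewrite (lt_le_trans _ yu)// divr_gt0.
near=> v Q.
have Cv : C `<=` [set y | open_halfspace v (y : sphere R hd)] by near: v.
apply: (@lt_le_trans _ _ (Q (C : set (borel_sphere R hd)))).
  by near: Q.
apply: le_measure; rewrite ?in_setE.
- by apply: closed_borel; exact: closed_ge_dotp.
- exact: measurable_open_halfspace.
- exact: Cv.
Unshelve. all: by end_near. Qed.

Lemma prob_halfspaceE (R : realType) (d : nat) (hd : (1 < d)%N)
    (P : sphere_prob R hd) (u : 'rV[R]_d) :
  prob_of P (halfspace u) = (1 - prob_of P (open_halfspace (- u)))%E.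
Proof.
rewrite /prob_of halfspaceC; apply: probability_setC.
exact: measurable_open_halfspace.
Qed.

Lemma prob_of_fin_num (R : realType) (d : nat) (hd : (1 < d)%N)
    (P : sphere_prob R hd) (u : 'rV[R]_d) :
  prob_of P (open_halfspace u) \is a fin_num.
Proof. by apply: fin_num_measure; exact: measurable_open_halfspace. Qed.

Lemma halfspace_usc (R : realType) (d : nat) (hd : (1 < d)%N)
    (P : sphere_prob R hd) (u : 'rV[R]_d) (a : R) :
  (prob_of P (halfspace u) < a%:E)%E ->
  \forall v \near u & Q \near P, (prob_of Q (halfspace v) < a%:E)%E.
Proof.
have E (Q : sphere_prob R hd) v : (prob_of Q (halfspace v) < a%:E)%E =
    ((1 - a)%:E < prob_of Q (open_halfspace (- v)))%E.
  rewrite prob_halfspaceE -(fineK (prob_of_fin_num _ _)) -EFinB !lte_fin.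
  by rewrite ltrBlDr -ltrBlDl.
rewrite E => /open_halfspace_lsc[[A B] [/= nA nB] AB].
have cN : - v @[v --> u] --> - u by exact: opp_continuous.
exists ([set v | A (- v)], B); first by split; [exact: cN|].
by move=> [v Q] [/= Av BQ]; rewrite E; exact: (AB (- v, Q)).
Qed.

(** * Semicontinuity of the depth *)

Lemma ahD_le (R : realType) (d : nat) (hd : (1 < d)%N) (P : sphere_prob R hd)
    (x u : sphere R hd) : 0 <= dotp x u ->
  (ahD P x <= prob_of P (halfspace u))%E.
Proof. by move=> xu; apply: ereal_inf_lbound; exists u. Qed.

Lemma le_ahD (R : realType) (d : nat) (hd : (1 < d)%N) (P : sphere_prob R hd)
    (x : sphere R hd) (a : \bar R) :
  (forall u : sphere R hd, 0 <= dotp x u -> (a <= prob_of P (halfspace u))%E) ->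
  (a <= ahD P x)%E.
Proof. by move=> H; apply: le_ereal_inf_tmp => _ [u xu <-]; exact: H. Qed.

Lemma ahD_le_max_depth (R : realType) (d : nat) (hd : (1 < d)%N)
    (P : sphere_prob R hd) (x : sphere R hd) : (ahD P x <= max_depth P)%E.
Proof. by apply: ereal_sup_ubound; exists x. Qed.

Lemma max_depth_le (R : realType) (d : nat) (hd : (1 < d)%N)
    (P : sphere_prob R hd) (a : \bar R) :
  (forall x, ahD P x <= a)%E -> (max_depth P <= a)%E.
Proof. by move=> H; apply: ge_ereal_sup => _ [x _ <-]; exact: H. Qed.

Lemma ahD_ge0 (R : realType) (d : nat) (hd : (1 < d)%N)
    (P : sphere_prob R hd) (x : sphere R hd) : (0 <= ahD P x)%E.
Proof. by apply: le_ahD => u _; exact: measure_ge0. Qed.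

Lemma measurable_halfspace (R : realType) (d : nat) (hd : (1 < d)%N)
    (u : 'rV[R]_d) :
  measurable [set y : borel_sphere R hd | halfspace u (y : sphere R hd)].
Proof. by apply: closed_borel; exact: closed_ge_dotp. Qed.

Lemma max_depth_le1 (R : realType) (d : nat) (hd : (1 < d)%N)
    (P : sphere_prob R hd) : (max_depth P <= 1)%E.
Proof.
apply: max_depth_le => x; apply: le_trans (ahD_le P (dotp_ge0 x)) _.
by apply: probability_le1; exact: measurable_halfspace.
Qed.

Lemma max_depth_fin_num (R : realType) (d : nat) (hd : (1 < d)%N)
    (P : sphere_prob R hd) : max_depth P \is a fin_num.
Proof.
rewrite ge0_fin_numE.
  by rewrite (le_lt_trans (max_depth_le1 P))// ltry.
exact: le_trans (ahD_ge0 P (sphere_point R hd)) (ahD_le_max_depth _ _).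
Qed.

Lemma near_sphere_dotp_gt0 (R : realType) (d : nat) (hd : (1 < d)%N)
    (x : sphere R hd) (w : 'rV[R]_d) :
  0 < dotp x w -> nbhs x [set y : sphere R hd | 0 < dotp y w].
Proof.
move=> xw; exact: (@dotpl_continuous R d hd w x _
  (open_nbhs_nbhs (conj (@open_gt R 0) xw))).
Qed.

(** A halfspace of mass less than [a] may have [x] on its boundary, in which
    case it does not contain all points near [x]; after tilting, it does. *)
Lemma ahD_usc (R : realType) (d : nat) (hd : (1 < d)%N)
    (P : sphere_prob R hd) (x : sphere R hd) (a : R) :
  (ahD P x < a%:E)%E ->
  \forall y \near x & Q \near P,
    (ahD (Q : sphere_prob R hd) (y : sphere R hd) < a%:E)%E.
Proof.
move=> /ereal_inf_lt[_ [u xu <-]] /halfspace_usc[[A B] [/= nA nB] AB].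
have [v [w [Av wv xw]]] := tilted_halfspace xu nA.
exists ([set y : sphere R hd | 0 < dotp y w], B).
  by split=> //; exact: near_sphere_dotp_gt0.
move=> [y Q] [/= yw BQ]; apply: le_lt_trans (ahD_le Q (ltW yw)) _.
by rewrite wv; exact: (AB (v, Q) (conj Av BQ)).
Qed.

Lemma max_depth_usc (R : realType) (d : nat) (hd : (1 < d)%N)
    (P : sphere_prob R hd) (a : R) :
  (max_depth P < a%:E)%E ->
  \forall Q \near P, (max_depth (Q : sphere_prob R hd) < a%:E)%E.
Proof.
rewrite -(fineK (max_depth_fin_num P)) lte_fin => Pa.
pose b := (fine (max_depth P) + a) / 2.
have [Pb ba] : fine (max_depth P) < b /\ b < a by rewrite midf_lt// midf_lt.
have /compact_near_coveringP K := @sphere_compact R d hd.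
have H : \forall Q \near P, [set: sphere R hd] `<=`
    [set x | (ahD (Q : sphere_prob R hd) x < b%:E)%E].
  apply: (K _ (nbhs P) (fun (Q : sphere_prob R hd) x => (ahD Q x < b%:E)%E)).
  move=> x _; apply: ahD_usc; apply: le_lt_trans (ahD_le_max_depth _ _) _.
  by rewrite -(fineK (max_depth_fin_num P)) lte_fin.
apply: filterS H => Q Qb.
apply: (@le_lt_trans _ _ b%:E); last by rewrite lte_fin.
by apply: max_depth_le => x; apply/ltW/Qb.
Qed.

(** If no point attained the maximal depth [r], upper semicontinuity and
    compactness would bound all depths by a single [b < r]. *)
Lemma medians_nonempty (R : realType) (d : nat) (hd : (1 < d)%N)
    (P : sphere_prob R hd) : medians P !=set0.
Proof.
apply/set0P/eqP => M0.
pose r := fine (max_depth P).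
have rE : max_depth P = r%:E by rewrite fineK// max_depth_fin_num.
have ltr x : (ahD P x < r%:E)%E.
  rewrite -rE lt_neqAle ahD_le_max_depth andbT; apply/eqP => xM.
  by have : medians P x by []; rewrite M0.
have /compact_near_coveringP K := @sphere_compact R d hd.
have : \forall b \near r^'-, [set: sphere R hd] `<=` [set x | (ahD P x < b%:E)%E].
  apply: (K _ r^'- (fun b x => (ahD P x < b%:E)%E)) => x _.
  have xfin : ahD P x \is a fin_num.
    by rewrite ge0_fin_numE ?ahD_ge0// (lt_trans (ltr x))// ltry.
  have := ltr x; rewrite -(fineK xfin) lte_fin => xr.
  pose b := (fine (ahD P x) + r) / 2.
  have [xb br] : fine (ahD P x) < b /\ b < r by rewrite !midf_lt.
  have : (ahD P x < b%:E)%E by rewrite -(fineK xfin) lte_fin.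
  move=> /ahD_usc[[A B] [/= nA nB] AB].
  exists (A, [set c | b < c]).
    by split=> //=; exact: nbhs_left_gt.
  move=> [y c] [/= Ay bc]; apply: lt_trans (AB (y, P) _) _.
    by split=> //; exact: nbhs_singleton.
  by rewrite lte_fin.
move=> H.
have [b br Hb] : exists2 b, b < r & forall x, (ahD P x < b%:E)%E.
  near r^'- => b; exists b; first by near: b; exact: nbhs_left_lt.
  by move=> x; have Hb : [set: sphere R hd] `<=` [set x | (ahD P x < b%:E)%E];
    [near: b; exact: H|exact: Hb].
have : (max_depth P <= b%:E)%E by apply: max_depth_le => x; rewrite ltW.
by rewrite rE lee_fin leNgt br.
Unshelve. all: by end_near. Qed.

(** * The lower bound [1 / (d + 1)] *)

(** At most [d + 1] halfspaces of mass less than [1 / (d + 1)] cannot cover the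
    sphere, so Helly's theorem applies to their complements. *)
Lemma finite_centerpoint (R : realType) (d : nat) (hd : (1 < d)%N)
    (P : sphere_prob R hd) (I : finType) (u : I -> sphere R hd) :
  (forall i, prob_of P (halfspace (u i)) < (d.+1%:R^-1)%:E)%E ->
  exists x : sphere R hd, forall i, dotp x (u i) < 0.
Proof.
move=> light.
have [|x xu] := @helly_open_halfspaces R d I (fun i => u i : 'rV_d); last first.
  have [x0|x0] := eqVneq x 0.
    exists (sphere_point R hd) => i; exfalso.
    by have := xu i; rewrite x0 dotp0l ltxx.
  have [s [c c0 sE]] := normalize hd x0.
  by exists s => i; rewrite sE dotpZl pmulr_rlt0.
move=> A dA.
apply: contrapT => noA.
pose H i := [set y : borel_sphere R hd | halfspace (u i) (y : sphere R hd)].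
have mH i : measurable (H i) by exact: measurable_halfspace.
pose p i := fine (P (H i)).
have pE i : P (H i) = (p i)%:E by rewrite fineK// fin_num_measure.
have cover (y : borel_sphere R hd) : exists2 i, i \in A & H i y.
  apply: contrapT => nH; apply: noA; exists (y : sphere R hd) => i iA.
  by rewrite ltNge; apply/negP => yi; apply: nH; exists i.
have [_ le1] : measurable (\big[setU/set0]_(i in A) H i) /\
    (P (\big[setU/set0]_(i in A) H i) <= \sum_(i in A) P (H i))%E.
  elim/big_ind2: _ => // [|B b C c [mB Bb] [mC Cc]]; first by rewrite measure0.
  split; first exact: measurableU.
  exact: (le_trans (measureU2 _ mB mC) (leeD Bb Cc)).
have [i0 i0A _] := cover (sphere_point R hd).
have coverE : \big[setU/set0]_(i in A) H i = [set: borel_sphere R hd].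
  rewrite -(bigcup_pred (mem A)) -subTset => y _.
  by have [i iA Hi] := cover y; exists i.
move: le1; rewrite coverE probability_setT.
under eq_bigr do rewrite pE.
rewrite sumEFin lee_fin leNgt => /negP; apply.
apply: (@lt_le_trans _ _ (\sum_(i in A) d.+1%:R^-1)).
  apply: ltr_sum => [|i _].
    by apply/hasP; exists i0 => //; exact: mem_index_enum.
  by rewrite -lte_fin -pE; exact: light.
by rewrite sumr_const -[leLHS]mulr_natl ler_pdivrMr ?ltr0n// mul1r ler_nat.
Qed.

(** Finite intersection property for the closed halfspaces [dotp x u <= 0] with
    [u] light. A point [x] common to all of them lies in no light halfspace:
    if [0 <= dotp x u] with [u] light, a tilted [u] would be light with
    [0 < dotp x u]. *)
Lemma max_depth_ge (R : realType) (d : nat) (hd : (1 < d)%N)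
    (P : sphere_prob R hd) : ((d.+1%:R^-1)%:E <= max_depth P)%E.
Proof.
pose B := [set u : sphere R hd | prob_of P (halfspace u) < (d.+1%:R^-1)%:E]%E.
have [x xB] : exists x : sphere R hd, forall u, B u -> dotp x u <= 0.
  pose f (u : sphere R hd) := [set x : sphere R hd | 0 <= dotp x (- (u : 'rV_d))].
  have := @sphere_compact R d hd; rewrite compact_In0 => /(_ (sphere R hd) B f).
  case.
  - exists f => [u _|u _]; first exact: closed_ge_dotp.
    by rewrite setTI.
  - move=> D DB.
    have [|x xD] := @finite_centerpoint R d hd P D (fun i => val i).
      by move=> i; have /DB/set_mem := valP i.
    exists x => u /= uD; rewrite /f/= dotpNr oppr_ge0.
    exact/ltW/(xD (FSetSub uD)).
  - move=> x xB; exists x => u /xB; rewrite /f/= dotpNr oppr_ge0.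
    by [].
apply: le_trans (ahD_le_max_depth P x); apply: le_ahD => u xu.
rewrite leNgt; apply/negP => /halfspace_usc[[A C] [/= nA nC] AC].
have [v [w [Av wv xw]]] := tilted_halfspace xu nA.
have : dotp x w <= 0.
  apply: xB; rewrite /B/= wv.
  by apply: (AC (v, P)); split=> //; exact: nbhs_singleton.
by rewrite leNgt xw.
Qed.

(** * Measures that do not charge great spheres *)

Lemma boundary_halfspace (R : realType) (d : nat) (hd : (1 < d)%N)
    (u : sphere R hd) :
  boundary (halfspace (u : 'rV_d)) = [set y | dotp y u = 0].
Proof.
have cu : continuous (fun y : 'rV[R]_d => dotp y u).
  move=> y; have c1 : z @[z --> y] --> y by exact: cvg_id.
  have c2 : (u : 'rV_d) @[_ --> y] --> (u : 'rV_d).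
    exact: (@cvg_cst _ (u : 'rV_d) _ (nbhs y)).
  exact: (cvg_comp _ _ (cvg_pair c1 c2) (@dotp_continuous R d (y, u : 'rV_d))).
have cH : closed (halfspace (u : 'rV_d)).
  apply: (@preimage_closed _ _ (fun y : 'rV[R]_d => dotp y u) [set x | 0 <= x]).
    by move=> y _; exact: cu.
  exact: closed_ge.
rewrite /boundary -(closure_id _).1//.
apply/seteqP; split=> [y [/= y0 nint]|y /= y0].
  apply/eqP; rewrite eq_le y0 andbT leNgt; apply/negP => y1; apply: nint.
  have oO : open (open_halfspace (u : 'rV_d)).
    apply: (@open_comp _ _ (fun y : 'rV[R]_d => dotp y u) [set x | 0 < x]).
      by move=> z _; exact: cu.
    exact: open_gt.
  suff : open_halfspace (u : 'rV_d) `<=` interior (halfspace (u : 'rV_d)) by exact.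
  by rewrite -open_subsetE// => z; exact: ltW.
split; first by rewrite /halfspace/= y0.
move=> inty.
have [t t0] := nbhs_line (- (u : 'rV_d)) inty.
rewrite /halfspace/= dotpDl y0 add0r dotpZl dotpC dotpNr dotp_sphere.
by rewrite mulrN1 oppr_ge0 leNgt t0.
Qed.

Lemma null_boundariesE (R : realType) (d : nat) (hd : (1 < d)%N)
    (P : sphere_prob R hd) (u : sphere R hd) : null_boundaries P ->
  prob_of P (halfspace u) = prob_of P (open_halfspace u).
Proof.
move=> nullP; have := nullP (halfspace u) (ex_intro2 _ _ u I erefl).
rewrite boundary_halfspace => P0.
have mo := @measurable_open_halfspace R d hd u.
have mc := @measurable_halfspace R d hd u.
have mE : measurable [set y : borel_sphere R hd | dotp (y : sphere R hd) u = 0].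
  rewrite (_ : mkset _ = [set y : borel_sphere R hd | halfspace u (y : sphere R hd)]
    `\` [set y : borel_sphere R hd | open_halfspace u (y : sphere R hd)]).
    by apply: measurableD => //; exact: mc.
  apply/seteqP; split=> y; rewrite /halfspace/open_halfspace/=.
    by move=> ->; rewrite lexx ltxx.
  by move=> [y0 /negP]; rewrite -leNgt => y1; apply/eqP; rewrite eq_le y0 y1.
apply/eqP; rewrite eq_le; apply/andP; split.
  rewrite -[leRHS]adde0 -P0; apply: (le_trans _ (measureU2 P mo mE)).
  apply: le_measure; rewrite ?in_setE.
  - exact: mc.
  - exact: (measurableU _ _ mo mE).
  - move=> y; rewrite /halfspace/open_halfspace/= le_eqVlt.
    by move=> /orP[/eqP <-|]; [right|left].
apply: le_measure; rewrite ?in_setE//.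
by move=> y; exact: ltW.
Qed.

(** The infimum defining the depth of a fixed [x] runs over the compact set of
    normals [u] with [0 <= dotp u x], so that a lower bound on the mass near
    each [u] is uniform. *)
Lemma max_depth_lsc (R : realType) (d : nat) (hd : (1 < d)%N)
    (P : sphere_prob R hd) (a : R) : null_boundaries P ->
  (a%:E < max_depth P)%E ->
  \forall Q \near P, (a%:E < max_depth (Q : sphere_prob R hd))%E.
Proof.
move=> nullP; rewrite -(fineK (max_depth_fin_num P)) lte_fin => aP.
pose b := (a + fine (max_depth P)) / 2.
have [ab bP] : a < b /\ b < fine (max_depth P) by rewrite !midf_lt.
have : (b%:E < max_depth P)%E by rewrite -(fineK (max_depth_fin_num P)) lte_fin.
move=> /ereal_sup_gt[_ [x _ <-] bx].
pose K := [set u : sphere R hd | 0 <= dotp u x].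
have /compact_near_coveringP cK : compact K by exact: compact_closed_ge.
have H : \forall Q \near P, K `<=`
    [set u : sphere R hd |
      (b%:E < prob_of (Q : sphere_prob R hd) (open_halfspace u))%E].
  apply: (cK _ (nbhs P)
    (fun (Q : sphere_prob R hd) (u : sphere R hd) =>
      (b%:E < prob_of Q (open_halfspace u))%E)).
  move=> u xu.
  have : (b%:E < prob_of P (open_halfspace (u : sphere R hd)))%E.
    by rewrite -null_boundariesE// (lt_le_trans bx)// ahD_le// dotpC.
  move=> /open_halfspace_lsc[[A B] [/= nA nB] AB].
  exists ([set v : sphere R hd | A v], B).
    by split=> //=; exact: (@sphere_val_continuous R d hd u _ nA).
  by move=> [v Q] [/= Av BQ]; exact: (AB (v : 'rV_d, Q)).
apply: filterS H => Q HQ.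
apply: (@lt_le_trans _ _ b%:E); first by rewrite lte_fin.
apply: le_trans (ahD_le_max_depth Q x); apply: le_ahD => u xu.
apply: (@le_trans _ _ (prob_of Q (open_halfspace u))).
  by apply/ltW/HQ; rewrite /K/= dotpC.
apply: le_measure; rewrite ?in_setE.
- exact: measurable_open_halfspace.
- exact: measurable_halfspace.
- by move=> y; exact: ltW.
Qed.

Lemma max_depth_le_half (R : realType) (d : nat) (hd : (1 < d)%N)
    (P : sphere_prob R hd) : null_boundaries P -> (max_depth P <= (2^-1)%:E)%E.
Proof.
move=> nullP; apply: max_depth_le => x.
have [u xu] := exists_orthogonal hd x.
have [w wE] : exists w : sphere R hd, w = - (u : 'rV_d) :> 'rV_d.
  apply: sphere_exists.
  by rewrite /enorm dotpNr dotpC dotpNr opprK dotp_sphere sqrtr1.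
have le1 : (ahD P x <= prob_of P (open_halfspace u))%E.
  by rewrite -null_boundariesE// ahD_le// xu.
have : (ahD P x <= prob_of P (halfspace w))%E.
  by apply: ahD_le; rewrite wE dotpNr xu oppr0.
rewrite wE prob_halfspaceE opprK; move: le1.
rewrite -(fineK (prob_of_fin_num P u)) -EFinB.
case: (ahD P x) => [r| |]; rewrite ?leye_eq ?leNye ?lee_fin// => r1 r2.
lra.
Qed.

(** * Continuity of the maximal depth and of the median set *)

Lemma near_not_median (R : realType) (d : nat) (hd : (1 < d)%N)
    (P : sphere_prob R hd) (s : sphere R hd) : null_boundaries P ->
  ~ medians P s ->
  \forall y \near s & Q \near P,
    ~ medians (Q : sphere_prob R hd) (y : sphere R hd).
Proof.
move=> nullP /eqP; rewrite /medians/= => sP.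
have : (ahD P s < max_depth P)%E by rewrite lt_neqAle sP ahD_le_max_depth.
move=> /[dup] sM.
have sfin : ahD P s \is a fin_num.
  by rewrite ge0_fin_numE ?ahD_ge0// (lt_le_trans sM)// leey.
rewrite -(fineK (max_depth_fin_num P)) -(fineK sfin) lte_fin => sr.
pose b := (fine (ahD P s) + fine (max_depth P)) / 2.
have [sb bP] : fine (ahD P s) < b /\ b < fine (max_depth P) by rewrite !midf_lt.
have : (ahD P s < b%:E)%E by rewrite -(fineK sfin) lte_fin.
move=> /ahD_usc[[A B] [/= nA nB] AB].
have : (b%:E < max_depth P)%E by rewrite -(fineK (max_depth_fin_num P)) lte_fin.
move=> /(max_depth_lsc nullP) nC.
exists (A, B `&` [set Q | (b%:E < max_depth Q)%E]).
  by split=> //=; exact: filterI.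
move=> [y Q] [/= Ay [BQ bQ]] yQ.
by have := lt_trans (AB (y, Q) (conj Ay BQ)) bQ; rewrite /= yQ ltxx.
Qed.

(** Upper hemicontinuity of the median set, the form of outer semicontinuity
    that compactness of the sphere makes uniform. *)
Lemma near_medians_sub (R : realType) (d : nat) (hd : (1 < d)%N)
    (P : sphere_prob R hd) (V : set (sphere R hd)) : null_boundaries P ->
  open V -> medians P `<=` V ->
  \forall Q \near P, medians (Q : sphere_prob R hd) `<=` V.
Proof.
move=> nullP oV PV.
have /compact_near_coveringP cK : compact (~` V).
  apply: (@subclosed_compact _ _ [set: sphere R hd]) => //.
    exact: open_closedC.
  exact: sphere_compact.
have H : \forall Q \near P, ~` V `<=` [set y | ~ medians (Q : sphere_prob R hd) y].
  apply: (cK _ (nbhs P) (fun (Q : sphere_prob R hd) y => ~ medians Q y)).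
  by move=> y Vy; apply: near_not_median => // /PV.
apply: filterS H => Q HQ y yQ; apply: contrapT => nVy.
exact: HQ nVy yQ.
Qed.

Lemma cvg_EFin_semicontinuous (R : realType) (T : Type) (F : set_system T)
    (f : T -> \bar R) (r : R) : Filter F ->
  (forall a, a < r -> \forall t \near F, (a%:E < f t)%E) ->
  (forall a, r < a -> \forall t \near F, (f t < a%:E)%E) ->
  f t @[t --> F] --> r%:E.
Proof.
move=> FF lsc usc A nA.
have /nbhs_ballP[e /= e0 eA] : nbhs r [set s | A s%:E] := nA.
have l : \forall t \near F, ((r - e)%:E < f t)%E.
  by apply: lsc; rewrite ltrBlDr ltrDl.
have u : \forall t \near F, (f t < (r + e)%:E)%E by apply: usc; rewrite ltrDl.
apply: filterS2 l u => t; rewrite /=; case E: (f t) => [s| |] //.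
rewrite !lte_fin => h1 h2; apply: eA; rewrite /ball/= ltr_norml.
by apply/andP; split; lra.
Qed.

Lemma max_depth_continuous_at (R : realType) (d : nat) (hd : (1 < d)%N)
    (P : sphere_prob R hd) : null_boundaries P ->
  {for P, continuous (fun Q : sphere_prob R hd => max_depth Q)}.
Proof.
move=> nullP.
suff : max_depth Q @[Q --> P] --> (fine (max_depth P))%:E.
  by rewrite fineK ?max_depth_fin_num.
have rE : (fine (max_depth P))%:E = max_depth P by rewrite fineK ?max_depth_fin_num.
apply: (@cvg_EFin_semicontinuous R _ (nbhs P) _ _ (nbhs_filter P)) => a aP.
  by apply: max_depth_lsc => //; rewrite -rE lte_fin.
by apply: max_depth_usc => //; rewrite -rE lte_fin.
Qed.

Lemma medians_outer (R : realType) (d : nat) (hd : (1 < d)%N)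
    (P : sphere_prob R hd) : null_boundaries P ->
  outer_semicontinuous_at (fun Q : sphere_prob R hd => medians Q) P.
Proof.
move=> nullP P_ s_ cP sM s cs; apply: contrapT => nM.
have [[A B] [/= nA nB] AB] := near_not_median nullP nM.
have := cs [set y | exists2 n, B (P_ n) & y = s_ n] A _ nA.
have [N _ NB] := cP _ nB.
case; first by exists N => // n /NB Bn; exists n.
by move=> _ [[n Bn ->] An]; exact: (AB (s_ n, P_ n) (conj An Bn) (sM n)).
Qed.

Lemma medians_cvg (R : realType) (d : nat) (hd : (1 < d)%N)
    (P : sphere_prob R hd) (x : sphere R hd) (P_ : nat -> sphere_prob R hd)
    (x_ : nat -> sphere R hd) :
  null_boundaries P -> medians P = [set x] -> P_ n @[n --> \oo] --> P ->
  (forall n, medians (P_ n) (x_ n)) -> x_ n @[n --> \oo] --> x.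
Proof.
move=> nullP Px cP xM A; rewrite nbhsE => -[V [oV Vx] VA].
have PV : medians P `<=` V by rewrite Px => _ ->.
have [N _ NV] := cP _ (near_medians_sub nullP oV PV).
by exists N => // n /NV nV; exact/VA/nV/xM.
Qed.

Lemma hausdorff_dist_set1 (R : realType) (d : nat) (A : set 'rV[R]_d)
    (x : 'rV[R]_d) (e : R) : A !=set0 ->
  (forall a, A a -> enorm (a - x) <= e) ->
  (0 <= hausdorff_dist A [set x] <= e%:E)%E.
Proof.
have enormB (y z : 'rV[R]_d) : enorm (y - z) = enorm (z - y).
  by rewrite -opprB /enorm dotpNr dotpC dotpNr opprK.
move=> [a Aa] Ae; apply/andP; split; rewrite /hausdorff_dist.
  rewrite le_max; apply/orP; right.
  apply: le_ereal_sup_tmp; eexists; first by exists x.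
  apply: le_ereal_inf_tmp => _ [y _ <-].
  suff : (0%:E <= (enorm (x - y))%:E)%E by [].
  by rewrite lee_fin sqrtr_ge0.
rewrite ge_max; apply/andP; split; apply: ge_ereal_sup => _ [y yA <-].
  apply: ge_ereal_inf; exists (enorm (y - x))%:E; first by exists x.
  by rewrite lee_fin Ae.
apply: ge_ereal_inf; exists (enorm (y - a))%:E; first by exists a.
by rewrite lee_fin (_ : y = x)// enormB Ae.
Qed.

(** The topology of the sphere comes from the sup norm; Euclidean balls are open
    because on the sphere the squared distance is [2 - 2 * dotp y x]. *)
Lemma open_enorm_lt (R : realType) (d : nat) (hd : (1 < d)%N)
    (x : sphere R hd) (e : R) : 0 < e ->
  open [set y : sphere R hd | enorm ((y : 'rV_d) - (x : 'rV_d)) < e].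
Proof.
move=> e0.
rewrite (_ : mkset _ = (fun y : sphere R hd => dotp y x) @^-1`
    [set r | 1 - e ^+ 2 / 2 < r]).
  apply: open_comp; last exact: open_gt.
  by move=> y _; exact: dotpl_continuous.
apply/funext => y; apply/propext; rewrite /preimage/= /enorm.
rewrite -[in X in X <-> _](gtr0_norm e0) -sqrtr_sqr ltr_sqrt ?exprn_gt0//.
rewrite dotpDl !dotpDr !dotpNr dotp_sphere.
rewrite (dotpC (- _)) dotpNr (dotpC (- _)) dotpNr dotp_sphere.
by split=> h; lra.
Qed.

Lemma medians_hausdorff (R : realType) (d : nat) (hd : (1 < d)%N)
    (P : sphere_prob R hd) (x : sphere R hd) (P_ : nat -> sphere_prob R hd) :
  null_boundaries P -> medians P = [set x] -> P_ n @[n --> \oo] --> P ->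
  hausdorff_dist (@sphere_val R d hd @` medians (P_ n))
    (@sphere_val R d hd @` medians P) @[n --> \oo] --> 0%E.
Proof.
move=> nullP Px cP.
have near_le (e : R) : 0 < e -> \forall n \near \oo,
    (0 <= hausdorff_dist (@sphere_val R d hd @` medians (P_ n))
      (@sphere_val R d hd @` medians P) <= e%:E)%E.
  move=> e0.
  have PV : medians P `<=` [set y | enorm ((y : 'rV_d) - (x : 'rV_d)) < e].
    by rewrite Px => _ -> /=; rewrite subrr /enorm dotp0l sqrtr0.
  have [N _ NV] := cP _ (near_medians_sub nullP (open_enorm_lt x e0) PV).
  exists N => // n /NV nV; rewrite /= Px image_set1.
  apply: hausdorff_dist_set1.
    by have [y My] := medians_nonempty (P_ n); exists y; exists y.
  by move=> _ [y My <-]; exact/ltW/nV.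
apply: cvg_EFin_semicontinuous => a a0; last first.
  have a20 : 0 < a / 2 by rewrite divr_gt0.
  have [N _ NV] := near_le _ a20; exists N => // n /NV /andP[_ h].
  by apply: le_lt_trans h _; rewrite lte_fin ltr_pdivrMr// ltr_pMr// ltr1n.
have [N _ NV] := near_le 1 ltr01; exists N => // n /NV /andP[h _].
by apply: lt_le_trans h; rewrite lte_fin.
Qed.

Unset Implicit Arguments.

Theorem theorem9 (R : realType) (d : nat) (hd : (1 < d)%N) :
  [/\
    (* (i) *)
    (forall P : sphere_prob R hd,
       ((d.+1%:R^-1)%:E <= max_depth P)%E /\ (max_depth P <= 1)%E) /\
    upper_semicontinuous (fun P : sphere_prob R hd => max_depth P),
    (* (ii) *)
    forall P : sphere_prob R hd, null_boundaries P ->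
      [/\ {for P, continuous (fun Q : sphere_prob R hd => max_depth Q)},
          (max_depth P <= (2^-1)%:E)%E &
          outer_semicontinuous_at
            (fun Q : sphere_prob R hd => medians Q) P]
    & (* (iii) *)
    forall (P : sphere_prob R hd) (x : sphere R hd),
      null_boundaries P -> medians P = [set x] ->
      [/\ (forall (P_ : nat -> sphere_prob R hd) (x_ : nat -> sphere R hd),
             P_ n @[n --> \oo] --> P ->
             (forall n, medians (P_ n) (x_ n)) ->
             exists k_ : nat -> nat,
               {homo k_ : i j / (i < j)%N} /\
               x_ (k_ i) @[i --> \oo] --> x),
          outer_semicontinuous_at (fun Q : sphere_prob R hd => medians Q) P,
          inner_semicontinuous_at (fun Q : sphere_prob R hd => medians Q) P &
          forall P_ : nat -> sphere_prob R hd,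
            P_ n @[n --> \oo] --> P ->
            hausdorff_dist (@sphere_val R d hd @` medians (P_ n))
                           (@sphere_val R d hd @` medians P)
              @[n --> \oo] --> 0%E]].
Proof.
split.
- split; first by move=> P; rewrite max_depth_ge max_depth_le1.
  move=> P a; rewrite lteNr -EFinN => /max_depth_usc Pa.
  by exists [set Q | (max_depth Q < (- a)%:E)%E] => // Q; rewrite lteNr.
- move=> P nullP; split; first exact: max_depth_continuous_at.
    exact: max_depth_le_half.
  exact: medians_outer.
- move=> P x nullP Px; split.
  + by move=> P_ x_ cP xM; exists id; split=> //;
      exact: (medians_cvg nullP Px cP xM).
  + exact: medians_outer.
  + move=> P_ cP s; rewrite Px => ->.
    have /choice[s_ sM] : forall n, exists s, medians (P_ n) s.
      by move=> n; have [y] := medians_nonempty (P_ n); exists y.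
    exists s_; split; first by exists 0%N => // n _; exact: sM.
    exact: (medians_cvg nullP Px cP sM).
  + by move=> P_ cP; exact: (medians_hausdorff nullP Px cP).
Qed.
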